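(* Let $\pi,\Psi,\widetilde\Psi\in\mathscr P^2(G)$, and let $\mathbf m_L=\mathcal R_L\Psi$, $\widetilde{\mathbf m}_L=\mathcal R_L\widetilde\Psi$ with $L\in\mathbb N$. Then $$\|\varphi_2(\mathbf m_L,\pi)-\varphi_2(\widetilde{\mathbf m}_L,\pi)\|_2\le\|\widehat Q_L\|\cdot\|\mathbf m_L-\widetilde{\mathbf m}_L\|.$$
   Context: $G\subset\mathbb R^d$ is open and bounded, $L^2(G)$ is taken with respect to Lebesgue measure with norm $\|\cdot\|_2$ and inner product $\langle\cdot,\cdot\rangle$, and $\mathscr P^2(G)\subset L^2(G)$ is the set of square-integrable probability densities on $G$. $R_0\equiv1$ and $(R_l)_{l\ge1}\subset L^2(G)$ are non-constant, with $\{R_l\}_{l\ge0}$ linearly independent. $\mathcal R_L\phi=(\langle R_l,\phi\rangle)_{l=1}^L\in\mathbb R^L$. For $\mathbf m=\mathcal R_L\Psi$ with some $\Psi\in\mathscr P^2(G)$, $\varphi_2(\mathbf m,\pi)$ denotes the unique minimiser of $\tfrac12\|\varphi-\pi\|_2^2$ over all $\varphi\in L^2(G)$ satisfying $\int_G\varphi\,d\mathbf x=1$ and $\mathcal R_L\varphi=\mathbf m$ (no positivity constraint). Let $\{Q_l\}_{l\ge0}$ be obtained from $\{R_l\}_{l\ge0}$ by Gram–Schmidt orthonormalisation, $Q_l=\sum_{j=0}^{l}\widehat Q_{l,j}R_j$ with $\widehat Q$ lower triangular; $\widehat Q_L$ is the upper-left $(L+1)\times(L+1)$ submatrix of $\widehat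 Q$ (indices $0,\dots,L$), $\|\widehat Q_L\|$ is its operator norm induced by the Euclidean norm, and $\|\cdot\|$ on vectors is the Euclidean norm. *)

(* Defs.v *)
From HB Require Import structures.
From mathcomp Require Import all_boot all_order all_algebra.
From mathcomp Require Import all_classical all_reals all_analysis.
From mathcomp Require Import measurable_realfun.

Set Implicit Arguments.
Unset Strict Implicit.
Unset Printing Implicit Defensive.

Import Order.TTheory GRing.Theory Num.Theory.
Import numFieldNormedType.Exports.

Local Open Scope classical_set_scope.
Local Open Scope ring_scope.

Definition borel_rV (R : realType) (n : nat) :=
  g_sigma_algebraType (@open 'rV[R]_n).

Lemma open_measurable_rV (R : realType) (n : nat) (U : set 'rV[R]_n) :
  open U -> measurable (U : set (borel_rV R n)).
Proof. by move=> oU; exact: sub_sigma_algebra. Qed.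

Section cons_rV.
Context (R : realType) (n : nat).

Definition cons_rV (p : measurableTypeR R * borel_rV R n) : borel_rV R n.+1 :=
  row_mx (const_mx p.1 : 'rV[R]_1) (p.2 : 'rV[R]_n).

Definition uncons_rV (v : borel_rV R n.+1) : measurableTypeR R * borel_rV R n :=
  ((lsubmx (v : 'rV[R]_(1 + n)) : 'rV[R]_1) ord0 ord0,
   rsubmx (v : 'rV[R]_(1 + n))).

Lemma cons_rVK : cancel cons_rV uncons_rV.
Proof.
case=> x v; rewrite /uncons_rV /cons_rV/=.
by rewrite row_mxKl row_mxKr mxE.
Qed.

Lemma cons_rV_ball (c : 'rV[R]_(1 + n)) (r : R) :
  cons_rV @^-1` (ball c r) =
  ball ((lsubmx c : 'rV[R]_1) ord0 ord0 : R) r `*` ball (rsubmx c) r.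
Proof.
apply/seteqP; split.
- case=> x v /= [r0 cv]; split => /=.
    have := cv ord0 (lshift n (ord0 : 'I_1)).
    by rewrite (@row_mxEl _ 1 1 n) !mxE.
  split => // i j; rewrite mxE.
  have := cv i (rshift 1 j).
  by rewrite (@row_mxEr _ 1 1 n).
- case=> x v /= [xc [r0 cv]]; split => // i j.
  rewrite (ord1 i); case: (@split_ordP 1 n j) => k ->.
    by rewrite (@row_mxEl _ 1 1 n) (ord1 k) mxE; move: xc; rewrite mxE.
  by rewrite (@row_mxEr _ 1 1 n); have := cv ord0 k; rewrite mxE.
Qed.

Lemma open_rV_rat m (U : set 'rV[R]_m) : open U ->
  U = \bigcup_(q in [set q : 'rV[rat]_m * rat |
                     ball (map_mx ratr q.1 : 'rV[R]_m) (ratr q.2) `<=` U])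
        ball (map_mx ratr q.1 : 'rV[R]_m) (ratr q.2).
Proof.
move=> oU; apply/seteqP; split => [v Uv|v [q qU /qU]//].
have /nbhs_ballP[e /= e0 eU] : nbhs v U by exact: open_nbhs_nbhs.
have [r] : exists r, ratr r \in `](0 : R), (e / 2)[.
  by apply: rat_in_itvoo; rewrite divr_gt0.
rewrite in_itv /= => /andP[r0 re].
have /choice[f fP] : forall j, exists q, `|v ord0 j - ratr q| < ratr r.
  move=> j; have [q] : exists q, ratr q \in `](v ord0 j - ratr r), (v ord0 j + ratr r)[.
    by apply: rat_in_itvoo; rewrite ltrBlDr -addrA ltrDl addr_gt0.
  rewrite in_itv /= => qP; exists q.
  by rewrite distrC ltr_distl.
have vq : ball (map_mx ratr (\row_j f j) : 'rV[R]_m) (ratr r) v.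
  split => // i j; rewrite (ord1 i) !mxE /ball /= distrC; exact: fP.
exists (\row_j f j, r) => //= w vw; apply: eU.
rewrite (splitr e); apply: (@le_ball _ _ _ (ratr r + ratr r)).
  by rewrite lerD ?ltW.
by apply: ball_triangle vw; exact: ball_sym.
Qed.

Lemma measurable_cons_rV : measurable_fun setT cons_rV.
Proof.
apply: (@measurability _ _ _ (borel_rV R n.+1) _ _ (@open 'rV[R]_n.+1)) => //.
move=> _ [U oU <-]; rewrite setTI (open_rV_rat oU) preimage_bigcup bigcup_mkcond.
apply: countable_bigcupT_measurable => [|q]; first exact: countableP.
case: ifP => _ //.
rewrite (cons_rV_ball (map_mx ratr q.1)); apply: measurableX.
  exact: measurable_ball.
by apply: open_measurable_rV; exact: ball_open.
Qed.

Lemma measurable_uncons_rV : measurable_fun setT uncons_rV.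
Proof.
apply/measurable_fun_pairP; split.
  apply: (measurability _ (RGenOpens.measurableE R)) => //.
  move=> _ [_ [a [b ->]] <-]; rewrite setTI; apply: open_measurable_rV.
  apply: open_comp; last exact: interval_open.
  have c : continuous (fun w : 'rV[R]_(1 + n) => (uncons_rV w).1 : R).
    have -> : (fun w : 'rV[R]_(1 + n) => (uncons_rV w).1 : R) =
      (fun w => w ord0 (lshift n ord0)) by apply/funext => w; rewrite /= mxE.
    exact: coord_continuous.
  by move=> v _; exact: c.
apply: (@measurability _ _ _ (borel_rV R n) _ _ (@open 'rV[R]_n)) => //.
move=> _ [U oU <-]; rewrite setTI; apply: open_measurable_rV.
apply: open_comp oU => v _ A /nbhs_ballP[e /= e0 eA].
apply/nbhs_ballP; exists e => //= w [_ vw]; apply: eA; split => // i j.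
by rewrite !mxE.
Qed.

End cons_rV.

Section lebesgue_cons.
Local Open Scope ereal_scope.
Context (R : realType) (n : nat).
Variable mu : {sigma_finite_measure set (borel_rV R n) -> \bar R}.

Let nu := pushforward (@lebesgue_measure R \x mu) (@cons_rV R n).

Let nu0 : nu set0 = 0.
Proof. by rewrite /nu /pushforward preimage_set0 measure0. Qed.

Let nu_ge0 A : 0 <= nu A.
Proof. by rewrite /nu /pushforward; exact: measure_ge0. Qed.

Let nu_sigma_additive : semi_sigma_additive nu.
Proof.
have mc A : measurable A -> measurable (@cons_rV R n @^-1` A).
  by move=> mA; rewrite -[X in measurable X]setTI; exact: measurable_cons_rV.
move=> F mF tF mUF; rewrite /nu /pushforward preimage_bigcup.
apply: measure_semi_sigma_additive => [i||]; first exact: mc.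
- apply/trivIsetP => /= i j _ _ ij; rewrite -preimage_setI.
  by move/trivIsetP : tF => /(_ _ _ _ _ ij) ->//; rewrite preimage_set0.
- by rewrite -preimage_bigcup; exact: mc.
Qed.

HB.instance Definition _ := isMeasure.Build _ _ _ nu
  nu0 nu_ge0 nu_sigma_additive.

Let nu_sigma_finite : sigma_finite setT nu.
Proof.
have /sigma_finiteP[F [UF ndF Foo]] := sigma_finiteT (@lebesgue_measure R).
have /sigma_finiteP[G [UG ndG Goo]] := sigma_finiteT mu.
exists (fun i => (@uncons_rV R n) @^-1` (F i `*` G i)).
  apply/esym; rewrite -preimage_bigcup.
  suff -> : \bigcup_i (F i `*` G i) = setT by rewrite preimage_setT.
  apply/seteqP; split=> // -[x y] _.
  have [i _ Fx] : (\bigcup_i F i) x by rewrite -UF.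
  have [j _ Gy] : (\bigcup_i G i) y by rewrite -UG.
  exists (maxn i j) => //; split.
  - by move: x Fx; exact/subsetPset/ndF/leq_maxl.
  - by move: y Gy; exact/subsetPset/ndG/leq_maxr.
move=> i; have [mF Fi] := Foo i; have [mG Gi] := Goo i; split.
  rewrite -[X in measurable X]setTI; apply: measurable_uncons_rV => //.
  exact: measurableX.
rewrite /nu /pushforward -comp_preimage.
rewrite (_ : _ \o _ = id) ?preimage_id//; last exact/funext/cons_rVK.
by rewrite product_measure1E// lte_mul_pinfty// ge0_fin_numE.
Qed.

HB.instance Definition _ := Measure_isSigmaFinite.Build _ _ _ nu
  nu_sigma_finite.

Definition lebesgue_cons :
  {sigma_finite_measure set (borel_rV R n.+1) -> \bar R} := nu.

End lebesgue_cons.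

Section lebesgue_nil.
Local Open Scope ereal_scope.
Context (R : realType).

Let nu := @dirac _ (borel_rV R 0) (0%R : 'rV[R]_0) R.

Let nu_fin : fin_num_fun nu.
Proof. by move=> A _; rewrite /nu diracE. Qed.

HB.instance Definition _ := Measure.on nu.
HB.instance Definition _ := Measure_isFinite.Build _ _ _ nu nu_fin.

Definition lebesgue_nil :
  {sigma_finite_measure set (borel_rV R 0) -> \bar R} := nu.

End lebesgue_nil.

(* The product measure on R x R^k, transported along cons_rV. *)
Fixpoint lebesgue_rV (R : realType) (n : nat) :
    {sigma_finite_measure set (borel_rV R n) -> \bar R} :=
  if n is k.+1 then lebesgue_cons (lebesgue_rV R k) else lebesgue_nil R.

Definition lebesgue_on (R : realType) (n : nat) (G : set 'rV[R]_n)
    (oG : open G) : {measure set (borel_rV R n) -> \bar R} :=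
  mrestr (lebesgue_rV R n) (open_measurable_rV oG).

(* The library norm on matrices is the maximum norm. *)
Definition euclidean_norm (R : realType) (n : nat) (v : 'cV[R]_n) : R :=
  Num.sqrt (\sum_(i < n) v i ord0 ^+ 2).

Definition operator_norm (R : realType) (m n : nat) (A : 'M[R]_(m, n)) : R :=
  sup [set euclidean_norm (A *m v) | v in [set v | euclidean_norm v <= 1]].

(* An element of L^2 is given by a representative: equality in L^2 is
   [= %[ae mu]]. *)
Notation L2 mu := (LfunType mu (lee1n 2)).

Section square_integrable.
Context d (T : measurableType d) (R : realType).
Context (mu : {measure set T -> \bar R}).
Implicit Types (f g phi pi : L2 mu) (r : nat -> L2 mu).

Definition l2_norm f : R := fine ('N[mu]_2%:E[EFin \o f])%E.

Definition l2_dot f g : R := \int[mu]_x (f x * g x).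

Definition density f : Prop :=
  (\forall x \ae mu, 0 <= f x) /\ \int[mu]_x f x = 1.

Definition linearly_independent r : Prop :=
  forall (n : nat) (a : 'I_n -> R),
    (\sum_(l < n) a l *: r l : L2 mu) = cst 0 %[ae mu] -> forall l, a l = 0.

(* The index is shifted: r_0 is left out, since its moment is the integral. *)
Definition moments r (L : nat) f : 'cV[R]_L := \col_(l < L) l2_dot (r l.+1) f.

Definition feasible r (L : nat) (m : 'cV[R]_L) : set (L2 mu) :=
  [set phi : L2 mu | \int[mu]_x phi x = 1 /\ moments r L phi = m].

Definition minimisers r (L : nat) (m : 'cV[R]_L) pi : set (L2 mu) :=
  [set phi : L2 mu | feasible r m phi /\
     forall psi, feasible r m psi ->
       2^-1 * l2_norm (phi - pi) ^+ 2 <= 2^-1 * l2_norm (psi - pi) ^+ 2].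

(* A representative of the minimiser, which is unique up to equality a.e.;
   xget defaults to pi only when there is no minimiser. *)
Definition phi2 r (L : nat) (m : 'cV[R]_L) pi : L2 mu :=
  xget pi (minimisers r m pi).

(* The list [:: Q_0; ...; Q_(n-1)]. *)
Fixpoint gram_schmidt_seq r (n : nat) : seq (L2 mu) :=
  if n is k.+1 then
    let s := gram_schmidt_seq r k in
    let u := r k - \sum_(q <- s) l2_dot q (r k) *: q in
    rcons s ((l2_norm u)^-1 *: u)
  else [::].

Definition gram_schmidt r (l : nat) : L2 mu := last 0 (gram_schmidt_seq r l.+1).

(* [Qhat] expresses the Gram-Schmidt functions in terms of r; it is determined
   by this when r is linearly independent. *)
Definition gram_schmidt_coefficients r (Qhat : nat -> nat -> R) : Prop :=
  (forall l j, (l < j)%N -> Qhat l j = 0) /\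
  forall l, gram_schmidt r l = (\sum_(j < l.+1) Qhat l j *: r j : L2 mu)
    %[ae mu].

End square_integrable.

(* Main.v *)
(* The minimiser is pi + P (Psi - pi), where P is the orthogonal projection onto
   the span of r_0, ..., r_L: every feasible function differs from Psi by an
   element orthogonal to that span, so Pythagoras applies.  Subtracting, pi
   cancels and the two minimisers differ by P (Psi - Psi').  Its squared norm is
   the sum of the squares of <q_l, Psi - Psi'>, and these numbers are the entries
   of Qhat_L times the vector of <r_j, Psi - Psi'>, whose entry of index 0
   vanishes because both densities have mass 1. *)
From HB Require Import structures.
Require Import Defs.
From mathcomp Require Import all_boot all_order all_algebra.
From mathcomp Require Import all_classical all_reals all_analysis.
From mathcomp Require Import measurable_realfun.

Set Implicit Arguments.
Unset Strict Implicit.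
Unset Printing Implicit Defensive.

Import Order.TTheory GRing.Theory Num.Theory.
Import numFieldNormedType.Exports.

Local Open Scope classical_set_scope.
Local Open Scope ring_scope.

(** * The inner product on representatives of square-integrable classes *)

Section inner_product.
Context d (T : measurableType d) (R : realType).
Context (mu : {measure set T -> \bar R}).
Implicit Types f g h : L2 mu.

Lemma integrable_l2_mul f g :
  mu.-integrable setT (EFin \o (fun x => f x * g x)).
Proof.
have /Lfun1_integrable := Lfun2_mul_Lfun1 (LfunP f) (LfunP g).
exact.
Qed.

Lemma l2_dotC f g : l2_dot f g = l2_dot g f.
Proof. by apply: eq_Rintegral => x _; rewrite mulrC. Qed.

Lemma l2_dot_is_linear f : linear_for *%R (l2_dot f).
Proof.
move=> a g h; rewrite /l2_dot -RintegralZl ?integrable_l2_mul//.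
rewrite -RintegralD//.
- by apply: eq_Rintegral => x _ /=; rewrite mulrDr mulrCA.
- exact: (integrableZl _ _ (integrable_l2_mul f g)).
- exact: integrable_l2_mul.
Qed.

HB.instance Definition _ f :=
  GRing.isLinear.Build R (L2 mu) R *%R (l2_dot f) (l2_dot_is_linear f).

Lemma l2_norm_sqr f : l2_norm f ^+ 2 = l2_dot f f.
Proof.
apply/EFin_inj; rewrite -powR_mulrn ?fine_ge0 ?Lnorm_ge0//.
(* The norm of an element of [L2 mu] is finite, so [fine] loses nothing. *)
rewrite -poweR_EFin finite_norm_fine powR_Lnorm//.
rewrite /l2_dot /Rintegral fineK; last first.
  by rewrite integrable_fin_num// integrable_l2_mul.
by apply: eq_integral => x _; rewrite /= powR_mulrn// real_normK// num_real.
Qed.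

Lemma l2_norm_ge0 f : 0 <= l2_norm f.
Proof. by rewrite fine_ge0// Lnorm_ge0. Qed.

(** Elements of [L2 mu] are functions, so an equality a.e. cannot be rewritten with directly; it is
    used through inner products. *)
Lemma l2_dot_ae_eq f g h : f = g %[ae mu] -> l2_dot f h = l2_dot g h.
Proof.
move=> fg; congr fine; apply: ae_eq_integral => //.
- exact: (measurable_int mu (integrable_l2_mul f h)).
- exact: (measurable_int mu (integrable_l2_mul g h)).
- by apply: filterS fg => x /= /(_ I) -> _.
Qed.

Lemma l2_dot_eq0_ae f : l2_dot f f = 0 -> f = cst 0 %[ae mu].
Proof.
by rewrite -l2_norm_sqr => /eqP; rewrite sqrf_eq0 => /eqP /fine_Lnormr_eq0.
Qed.

Lemma l2_norm_eq0_dot f h : l2_norm f = 0 -> l2_dot f h = 0.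
Proof.
move=> /fine_Lnormr_eq0 f0; rewrite (@l2_dot_ae_eq _ 0)// l2_dotC.
exact: linear0.
Qed.

Lemma l2_norm_sqrD f g :
  l2_norm (f + g) ^+ 2 = l2_norm f ^+ 2 + 2 * l2_dot f g + l2_norm g ^+ 2.
Proof.
rewrite !l2_norm_sqr linearD/= !(l2_dotC (f + g)) !linearD/= (l2_dotC g f).
by rewrite mulr_natl mulr2n !addrA.
Qed.

Lemma l2_norm_sqr_orthonormal (n : nat) (q : nat -> L2 mu) (c : nat -> R) :
  (forall i j, (i < n)%N -> (j < n)%N -> l2_dot (q i) (q j) = (i == j)%:R) ->
  l2_norm (\sum_(l < n) c l *: q l) ^+ 2 = \sum_(l < n) c l ^+ 2.
Proof.
move=> qq; rewrite l2_norm_sqr linear_sum; apply: eq_bigr => l _ /=.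
rewrite linearZ/= l2_dotC linear_sum (bigD1 l)//= big1 ?addr0.
  by rewrite linearZ/= qq// eqxx mulr1 expr2.
by move=> k kl; rewrite linearZ/= qq// eq_sym (_ : (_ == _) = false) ?mulr0//; apply/negbTE.
Qed.

End inner_product.

(** * Orthonormality of the Gram-Schmidt functions and their relation to [r] *)

Section gram_schmidt.
Context d (T : measurableType d) (R : realType).
Context (mu : {measure set T -> \bar R}) (r : nat -> L2 mu).
Local Notation q := (gram_schmidt r).

Lemma gram_schmidt_seqE n : gram_schmidt_seq r n = mkseq q n.
Proof.
by elim: n => // n IHn; rewrite mkseqS -IHn /gram_schmidt /= last_rcons.
Qed.

Let residual k : L2 mu := r k - \sum_(l < k) l2_dot (q l) (r k) *: q l.

Lemma gram_schmidtE k : q k = (l2_norm (residual k))^-1 *: residual k.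
Proof.
rewrite {1}/gram_schmidt /= last_rcons gram_schmidt_seqE /residual.
by rewrite big_map -[X in iota 0 X]subn0 -/(index_iota 0 k) big_mkord.
Qed.

Variable Qhat : nat -> nat -> R.
Hypothesis QhatP : gram_schmidt_coefficients r Qhat.

(** Lower triangularity lets the sum run up to any [n > l], so that all rows share one range. *)
Lemma l2_dot_gram_schmidt n l f : (l < n)%N ->
  l2_dot (q l) f = \sum_(j < n) Qhat l j * l2_dot (r j) f.
Proof.
move=> ln; have [Q0 Qr] := QhatP; rewrite (l2_dot_ae_eq _ (Qr l)).
rewrite l2_dotC linear_sum /=.
rewrite (big_ord_widen n (fun j => l2_dot f (Qhat l j *: r j)))// big_mkcond.
apply: eq_bigr => j _ /=; rewrite linearZ/= (l2_dotC f).
by have [//|lj] := ltnP j l.+1; rewrite Q0// mul0r.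
Qed.

Hypothesis r_independent : linearly_independent r.

Lemma residual_neq0 k : l2_norm (residual k) != 0.
Proof.
apply/eqP => u0.
(* A zero residual gives a linear relation with coefficient 1 at [r k]. *)
pose c l := l2_dot (q l) (r k).
pose a (j : 'I_k.+1) : R :=
  if (j < k)%N then - \sum_(l < k) c l * Qhat l j else 1.
suff /r_independent/(_ ord_max) :
    (\sum_(l < k.+1) a l *: r l : L2 mu) = cst 0 %[ae mu].
  by rewrite /a ltnn => /eqP; rewrite oner_eq0.
set s := \sum_(_ < _) _.
(* It suffices to test against every [h]: taking [h := s] gives [<s, s> = 0], because the residual
   has norm 0. *)
suff sE h : l2_dot s h = l2_dot (residual k) h.
  by apply: l2_dot_eq0_ae; rewrite sE l2_norm_eq0_dot.
rewrite ![l2_dot _ h]l2_dotC linearB/= /s !linear_sum big_ord_recr/=.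
rewrite linearZ/= /a ltnn mul1r addrC; congr (_ + _).
(* Expanding each [q l] through [Qhat] and exchanging the two sums produces the coefficients [a]. *)
rewrite [RHS](eq_bigr (fun l : 'I_k =>
  \sum_(j < k) - (c l * Qhat l j) * l2_dot h (r j))).
  rewrite exchange_big; apply: eq_bigr => j _ /=.
  by rewrite linearZ/= ltn_ord -sumrN mulr_suml.
move=> l _; rewrite linearZ/= -/(c l) (l2_dotC h).
rewrite (@l2_dot_gram_schmidt k)// mulr_sumr -sumrN.
by apply: eq_bigr => j _; rewrite (l2_dotC h) mulNr mulrA.
Qed.

Lemma gram_schmidt_expansion k :
  r k = l2_norm (residual k) *: q k + \sum_(l < k) l2_dot (q l) (r k) *: q l.
Proof.
by rewrite gram_schmidtE scalerA mulfV ?residual_neq0// scale1r subrK.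
Qed.

Lemma gram_schmidt_orthonormal i j : l2_dot (q i) (q j) = (i == j)%:R.
Proof.
wlog ij : i j / (i <= j)%N.
  by move=> H; have [/H//|/ltnW/H ji] := leqP i j; rewrite l2_dotC eq_sym.
have [n jn] : exists n, (j < n)%N by exists j.+1.
(* Induction on a strict bound [n] for the larger index; [qlt] is orthonormality below [j]. *)
elim: n => // n IHn in i j ij jn *.
have qlt l m : (l <= m)%N -> (m < j)%N -> l2_dot (q l) (q m) = (l == m)%:R.
  by move=> lm mj; apply: IHn => //; exact: leq_trans mj _.
move: ij; rewrite leq_eqVlt => /predU1P[->|ij].
  rewrite eqxx gram_schmidtE linearZ/= l2_dotC linearZ/= -l2_norm_sqr mulrA.
  by rewrite -invfM -expr2 mulVf// sqrf_eq0 residual_neq0.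
(* In the sum subtracted from [r j], only the term [l = i] survives, and it cancels [<q i, r j>]. *)
rewrite ltn_eqF// (gram_schmidtE j) linearZ/= linearB/= linear_sum.
rewrite (bigD1 (Ordinal ij))//= big1 ?addr0; last first.
  move=> l li; rewrite linearZ/=.
  suff -> : l2_dot (q i) (q l) = 0 by rewrite mulr0.
  have {}li : (l == i :> nat) = false by apply/negbTE.
  have [il|/ltnW il] := leqP i l; first by rewrite qlt// eq_sym li.
  by rewrite l2_dotC qlt// li.
by rewrite linearZ/= qlt// eqxx mulr1 subrr mulr0.
Qed.

(** [r k] lies in the span of [q 0, ..., q k], so orthogonality passes from [q] to [r] without
    inverting [Qhat]. *)
Lemma gram_schmidt_dot_eq0 k f :
  (forall l, (l <= k)%N -> l2_dot (q l) f = 0) -> l2_dot (r k) f = 0.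
Proof.
move=> qf; rewrite gram_schmidt_expansion l2_dotC linearD/= linearZ/= linear_sum.
rewrite big1 ?addr0; first by rewrite (l2_dotC f) qf ?mulr0.
by move=> l _; rewrite linearZ/= (l2_dotC f) qf ?mulr0// ltnW.
Qed.

End gram_schmidt.

(** * The Euclidean norm and the operator norm it induces *)

Section euclidean_norm.
Context (R : realType).

Lemma euclidean_norm_ge0 n (v : 'cV[R]_n) : 0 <= euclidean_norm v.
Proof. exact: sqrtr_ge0. Qed.

Lemma euclidean_norm_sqr n (v : 'cV[R]_n) :
  euclidean_norm v ^+ 2 = \sum_(i < n) v i ord0 ^+ 2.
Proof. by rewrite sqr_sqrtr// sumr_ge0// => i _; exact: sqr_ge0. Qed.

Lemma euclidean_norm0 n : euclidean_norm (0 : 'cV[R]_n) = 0.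
Proof.
by rewrite /euclidean_norm big1 ?sqrtr0// => i _; rewrite mxE expr0n.
Qed.

Lemma euclidean_normZ n a (v : 'cV[R]_n) :
  euclidean_norm (a *: v) = `|a| * euclidean_norm v.
Proof.
rewrite -sqrtr_sqr -sqrtrM ?sqr_ge0// mulr_sumr; congr Num.sqrt.
by apply: eq_bigr => i _; rewrite mxE exprMn.
Qed.

Lemma ler_coord_euclidean_norm n (v : 'cV[R]_n) i :
  `|v i ord0| <= euclidean_norm v.
Proof.
rewrite -sqrtr_sqr ler_sqrt; last by apply: sumr_ge0 => j _; exact: sqr_ge0.
by rewrite (bigD1 i)//= lerDl sumr_ge0// => j _; exact: sqr_ge0.
Qed.

(** [sup] is known to bound the set only once the set is bounded above. *)
Lemma operator_norm_has_sup m n (A : 'M[R]_(m, n)) :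
  has_sup [set euclidean_norm (A *m v) | v in [set v | euclidean_norm v <= 1]].
Proof.
split.
  exists (euclidean_norm (A *m 0)), 0 => //=.
  by rewrite euclidean_norm0.
(* Coordinates of a vector of the unit ball are at most 1 in absolute value, so entry [i] of
   [A *m v] is bounded by the absolute sum of row [i]. *)
exists (Num.sqrt (\sum_(i < m) (\sum_(j < n) `|A i j|) ^+ 2)) => _ [v /= v1 <-].
rewrite ler_wsqrtr// ler_sum// => i _; rewrite -real_normK ?num_real//.
rewrite ler_sqr ?nnegrE ?sumr_ge0// mxE (le_trans (ler_norm_sum _ _ _))//.
apply: ler_sum => j _; rewrite normrM ler_piMr//.
exact: le_trans (ler_coord_euclidean_norm v j) v1.
Qed.

Lemma euclidean_norm_mulmx m n (A : 'M[R]_(m, n)) v :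
  euclidean_norm (A *m v) <= operator_norm A * euclidean_norm v.
Proof.
have [v0|v0] := eqVneq (euclidean_norm v) 0.
  have -> : v = 0.
    apply/matrixP => i j; rewrite mxE (ord1 j).
    by apply/eqP; rewrite -normr_le0 -v0 ler_coord_euclidean_norm.
  by rewrite mulmx0 !euclidean_norm0 mulr0.
have vgt0 : 0 < euclidean_norm v by rewrite lt0r v0 euclidean_norm_ge0.
rewrite -ler_pdivrMr//; apply: ub_le_sup.
  by have [_] := operator_norm_has_sup A.
(* The normalised vector lies in the unit ball, and homogeneity recovers [v]. *)
exists ((euclidean_norm v)^-1 *: v) => /=.
  by rewrite euclidean_normZ gtr0_norm ?invr_gt0// mulVf.
by rewrite -scalemxAr euclidean_normZ gtr0_norm ?invr_gt0// mulrC.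
Qed.

End euclidean_norm.

(** * Orthogonal projection and the minimiser *)

Section projection.
Context d (T : measurableType d) (R : realType).
Context (mu : {measure set T -> \bar R}) (r : nat -> L2 mu).
Hypothesis r0 : r 0%N = cst 1 %[ae mu].
Hypothesis r_independent : linearly_independent r.
Variable Qhat : nat -> nat -> R.
Hypothesis QhatP : gram_schmidt_coefficients r Qhat.
Local Notation q := (gram_schmidt r).
Implicit Types f g pi phi psi : L2 mu.

Lemma l2_dot_r0 f : l2_dot (r 0%N) f = \int[mu]_x f x.
Proof.
congr fine; apply: ae_eq_integral => //.
- exact: (measurable_int mu (integrable_l2_mul (r 0%N) f)).
- exact/measurable_EFinP.
- by apply: filterS r0 => x /= /(_ I) -> _; rewrite mul1r.
Qed.

(** Since [r 0] is 1 a.e., the mass constraint is the moment of index 0, and all constraints take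
    one form. *)
Lemma feasibleP L f phi : \int[mu]_x f x = 1 ->
  feasible r (moments r L f) phi <->
  forall j, (j <= L)%N -> l2_dot (r j) phi = l2_dot (r j) f.
Proof.
move=> f1; split=> [[phi1 /matrixP m] [|j] jL|H].
- by rewrite !l2_dot_r0 phi1.
- by have := m (Ordinal jL) ord0; rewrite !mxE.
- split; first by rewrite -l2_dot_r0 H// l2_dot_r0.
  by apply/matrixP => i j; rewrite !mxE H.
Qed.

Definition projection L f : L2 mu := \sum_(l < L.+1) l2_dot (q l) f *: q l.

Lemma projectionB L f g : projection L f - projection L g = projection L (f - g).
Proof.
by rewrite -sumrB; apply: eq_bigr => l _; rewrite -scalerBl linearB.
Qed.

Lemma gram_schmidt_dot_projection L l f : (l <= L)%N ->
  l2_dot (q l) (projection L f) = l2_dot (q l) f.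
Proof.
move=> lL; rewrite linear_sum (bigD1 (Ordinal (lL : (l < L.+1)%N)))//= big1.
  by rewrite addr0 linearZ/= (gram_schmidt_orthonormal QhatP)// eqxx mulr1.
move=> k kl; rewrite linearZ/= (gram_schmidt_orthonormal QhatP)// eq_sym.
by rewrite (_ : (_ == _) = false) ?mulr0//; apply/negbTE.
Qed.

(** Against [q l] with [l <= L] the projection is invisible, so [pi] cancels and [<q l, f>] remains;
    this then passes to the [r j]. *)
Lemma feasible_projection L pi f : \int[mu]_x f x = 1 ->
  feasible r (moments r L f) (pi + projection L (f - pi)).
Proof.
move=> f1; apply/feasibleP => // j jL; apply/eqP; rewrite -subr_eq0 -linearB/=.
apply/eqP/(gram_schmidt_dot_eq0 QhatP) => // l lj.
rewrite linearB/= linearD/= gram_schmidt_dot_projection ?(leq_trans lj)//.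
by rewrite linearB/= addrCA subrr addr0 subrr.
Qed.

Lemma feasible_orthogonal L f g phi psi : \int[mu]_x f x = 1 ->
  feasible r (moments r L f) phi -> feasible r (moments r L f) psi ->
  l2_dot (phi - psi) (projection L g) = 0.
Proof.
move=> f1 /(feasibleP _ _ f1) Hphi /(feasibleP _ _ f1) Hpsi.
rewrite linear_sum big1// => l _; rewrite linearZ/= (l2_dotC (phi - psi)).
rewrite (l2_dot_gram_schmidt QhatP (phi - psi) (ltn_ord l)) big1 ?mulr0// => j _.
by rewrite linearB/= (Hphi j (ltn_ord j))
  (Hpsi j (ltn_ord j)) subrr mulr0.
Qed.

(** The cross term vanishes because [psi] and [pi + projection L (f - pi)] are both feasible. *)
Lemma feasible_pythagoras L pi f psi : \int[mu]_x f x = 1 ->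
  feasible r (moments r L f) psi ->
  l2_norm (psi - pi) ^+ 2 =
  l2_norm (psi - (pi + projection L (f - pi))) ^+ 2 +
  l2_norm (projection L (f - pi)) ^+ 2.
Proof.
move=> f1 fpsi.
have -> : psi - pi =
    psi - (pi + projection L (f - pi)) + projection L (f - pi).
  by rewrite opprD addrA subrK.
rewrite l2_norm_sqrD (feasible_orthogonal _ f1 fpsi) ?mulr0 ?addr0//.
exact: feasible_projection.
Qed.

(** [phi2] is some chosen minimiser, determined only a.e.; hence a distance equal to 0 instead of an
    equality of functions. *)
Lemma phi2_projection L pi f : \int[mu]_x f x = 1 ->
  l2_norm (phi2 r (moments r L f) pi - (pi + projection L (f - pi))) = 0.
Proof.
move=> f1; set p := pi + _.
have pf : feasible r (moments r L f) p by exact: feasible_projection.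
have minp : minimisers r (moments r L f) pi p.
  split=> // psi fpsi; rewrite ler_pM2l ?invr_gt0//.
  by rewrite (feasible_pythagoras pi f1 fpsi) /p addrAC subrr add0r lerDr sqr_ge0.
(* As [p] is a minimiser, [xget] does not fall back on its default. *)
have [fphi] : minimisers r (moments r L f) pi (phi2 r (moments r L f) pi).
  exact: xgetI minp.
(* Comparing the chosen minimiser with [p] by Pythagoras leaves its squared distance to [p] at most
   0. *)
move=> /(_ p pf); rewrite ler_pM2l ?invr_gt0// (feasible_pythagoras pi f1 fphi).
rewrite {2}/p [p - pi]addrAC subrr add0r gerDr => n0.
by apply/eqP; rewrite -sqrf_eq0 eq_le n0 sqr_ge0.
Qed.

Lemma l2_norm_phi2B L pi f g : \int[mu]_x f x = 1 -> \int[mu]_x g x = 1 ->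
  l2_norm (phi2 r (moments r L f) pi - phi2 r (moments r L g) pi) =
  l2_norm (projection L (f - g)).
Proof.
move=> f1 g1; apply/eqP; rewrite -(@eqrXn2 _ 2) ?l2_norm_ge0//; apply/eqP.
have pf := phi2_projection L pi f1; have pg := phi2_projection L pi g1.
set F := phi2 _ _ _ in pf *; set G := phi2 _ _ _ in pg *.
(* Both minimisers are known only up to norm 0, so the difference is identified by testing against
   every [h]; using this in each argument equates the norms. *)
have FG h : l2_dot h (F - G) = l2_dot h (projection L (f - g)).
  have := l2_norm_eq0_dot h pf; rewrite l2_dotC linearB linearD.
  move=> /subr0_eq /= Fh.
  have := l2_norm_eq0_dot h pg; rewrite l2_dotC linearB linearD.
  move=> /subr0_eq /= Gh.
  rewrite linearB/= Fh Gh opprD addrACA subrr add0r -linearB/= projectionB.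
  by rewrite opprB addrA subrK.
by rewrite !l2_norm_sqr FG l2_dotC FG.
Qed.

Lemma l2_norm_projection L f :
  l2_norm (projection L f) =
  euclidean_norm ((\matrix_(i < L.+1, j < L.+1) Qhat i j) *m
                  (\col_(j < L.+1) l2_dot (r j) f)).
Proof.
apply/eqP; rewrite -(@eqrXn2 _ 2) ?l2_norm_ge0 ?euclidean_norm_ge0//.
rewrite euclidean_norm_sqr.
rewrite (@l2_norm_sqr_orthonormal _ _ _ _ L.+1 q (fun l => l2_dot (q l) f));
  last first.
  by move=> i j _ _; exact: (gram_schmidt_orthonormal QhatP).
apply/eqP/eq_bigr => l _; congr (_ ^+ 2).
rewrite (l2_dot_gram_schmidt QhatP _ (ltn_ord l)) mxE.
by apply: eq_bigr => j _; rewrite !mxE.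
Qed.

End projection.

Theorem lemma4p2 (R : realType) (d : nat) (G : set 'rV[R]_d)
    (oG : open G) (bG : bounded_set G)
    (r : nat -> L2 (lebesgue_on oG))
    (r0 : r 0%N = cst 1 %[ae lebesgue_on oG])
    (r_nonconstant : forall l : nat, (0 < l)%N ->
       ~ exists c : R, r l = cst c %[ae lebesgue_on oG])
    (r_independent : linearly_independent r)
    (Qhat : nat -> nat -> R) (QhatP : gram_schmidt_coefficients r Qhat)
    (pi Psi Psi' : L2 (lebesgue_on oG))
    (pi_density : density pi) (Psi_density : density Psi)
    (Psi'_density : density Psi') (L : nat) :
  l2_norm (phi2 r (moments r L Psi) pi - phi2 r (moments r L Psi') pi) <=
  operator_norm (\matrix_(i < L.+1, j < L.+1) Qhat i j) *
  euclidean_norm (moments r L Psi - moments r L Psi').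
Proof.
have [[_ f1] [_ g1]] := (Psi_density, Psi'_density).
rewrite (l2_norm_phi2B r0 r_independent QhatP)//.
rewrite (l2_norm_projection r_independent QhatP).
apply: le_trans (euclidean_norm_mulmx _ _) _.
(* The left vector has one more entry, of index 0: the difference of the two masses, which is 0. *)
suff -> : euclidean_norm (\col_(j < L.+1) l2_dot (r j) (Psi - Psi')) =
  euclidean_norm (moments r L Psi - moments r L Psi') by [].
congr Num.sqrt; rewrite big_ord_recl mxE linearB/=.
rewrite !(l2_dot_r0 r0) f1 g1 subrr expr0n add0r.
by apply: eq_bigr => j _; rewrite !mxE linearB.
Qed.
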